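(* There exists a fixed modulus $m$ such that infinitely many integers $n\geq 2$ ramify modulo $m$.
   Context: For a positive integer $k$, the residue of $n$ modulo $k$ means the least nonnegative residue, i.e. the integer $a\in\{0,1,\dots,k-1\}$ with $n\equiv a\pmod k$. Let $n\geq 2$ be an integer, let $m$ be a modulus (a positive integer), and let $a_1$ be the residue of $n$ modulo $m$. The integer $n$ is said to ramify modulo $m$ (to be a ramifier modulo $m$) if there exists a positive integer $r<m$ such that the residue $a_2$ of $n$ modulo $r$ satisfies $a_1+a_2=m$. *)

(* Defs.v *)
From mathcomp Require Import all_boot.

Set Implicit Arguments.
Unset Strict Implicit.
Unset Printing Implicit Defensive.

(* For k > 0, [n %% k] is the least nonnegative residue of n modulo k. *)
Definition ramifies (m n : nat) : Prop :=
  exists r : nat, [/\ 0 < r, r < m & n %% m + n %% r = m].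

(* Main.v *)
Require Import Defs.
From mathcomp Require Import all_boot.
From mathcomp Require Import classical_sets cardinality.

Local Open Scope classical_set_scope.

(** Whether [n] ramifies modulo [m] depends only on the residues of [n] modulo
    the integers up to [m], so a single ramifier yields a whole arithmetic
    progression of them.  The modulus [3] already has one: with [r = 2], the
    largest residues [2] and [1] add up to [3], and they occur together exactly
    when [n] is congruent to [-1] modulo [6]. *)

Lemma ramifies3 (k : nat) : ramifies 3 (k * 6 + 5).
Proof.
exists 2; split=> //.
by rewrite {1}(mulnA k 2 3) modnMDl (mulnA k 3 2) modnMDl.
Qed.

Theorem theorem3p10 :
  exists m : nat,
    (0 < m)%N /\ infinite_set [set n : nat | (2 <= n)%N /\ ramifies m n].
Proof.
exists 3; split=> // finA.
(* The progression embeds all of [nat] injectively into the set of ramifiers. *)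
pose f k := k * 6 + 5.
apply: infinite_nat.
have injf : injective f by move=> i j /addIn /eqP; rewrite eqn_pmul2r // => /eqP.
apply: sub_finite_set (finite_preimage (f := f) (in2W injf) finA) => k _.
by split; [rewrite /f addnC | apply: ramifies3].
Qed.
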